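(* Let $n\ge 3$ and let $Dj_n=(C_n\Box P_2)+K_1$ be the djembe graph. Then $$cn_{\chi}(Dj_n)=\begin{cases} n, & n \text{ even},\\ n-1, & n\text{ odd},\end{cases} \qquad\text{and}\qquad cn^c_{\chi}(Dj_n)=\begin{cases} n^2, & n \text{ even},\\ 2(n-1)^2, & n\text{ odd}.\end{cases}$$
   Context: All graphs are finite, simple, undirected and connected. A chromatic colouring of a graph $G$ is a proper vertex colouring with exactly $\chi(G)$ colours $c_1,\ldots,c_\ell$, $\ell=\chi(G)$; the colour class of $c_i$ is denoted $\mathcal{C}_i$ and $\theta(c_i)=|\mathcal{C}_i|$. A $\chi^-$-colouring of $G$ is a chromatic colouring in which the maximum possible number of vertices gets colour $c_1$, then (subject to that) the maximum possible number of the remaining vertices gets $c_2$, then the maximum possible number of the remaining vertices gets $c_3$, and so on; that is, $(\theta(c_1),\ldots,\theta(c_\ell))$ is lexicographically maximal among all chromatic colourings of $G$. With respect to a $\chi^-$-colouring, the chromatic curling number is $cn_{\chi}(G)=\max\{\theta(c_i):1\le i\le \ell\}$ and the chromatic compound curling number is $cn^c_{\chi}(G)=\prod_{i=1}^{\ell}\theta(c_i)$. The djembe graph $Dj_n$ is obtained by joining the corresponding vertices of two cycles of the same order $n$ and joining all vertices of the two cycles to one external vertex; i.e. $Dj_n=(C_n\Box P_2)+K_1$, where $\Box$ is the Cartesian product and $+$ the join. *)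

(* Defs.v *)
From HB Require Import structures.
From mathcomp Require Import all_boot all_order.

Set Implicit Arguments.
Unset Strict Implicit.
Unset Printing Implicit Defensive.

Import Order.TTheory.

Record sgraph := SGraph {
  vertex :> finType;
  adj : rel vertex;
  adj_sym : symmetric adj;
  adj_irr : irreflexive adj
}.
Arguments adj {s}.

Section Constructions.

(* The conjunct [i != j] only excludes the loop that [ordS] would create when
   n = 1; it is redundant for n >= 3, when this is the usual cycle. *)
Definition cycle_adj n : rel 'I_n :=
  fun i j => (i != j) && ((j == ordS i) || (i == ordS j)).

Lemma cycle_adj_sym n : symmetric (@cycle_adj n).
Proof. by move=> i j; rewrite /cycle_adj eq_sym orbC. Qed.

Lemma cycle_adj_irr n : irreflexive (@cycle_adj n).
Proof. by move=> i; rewrite /cycle_adj eqxx. Qed.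

Definition cycle_graph n := SGraph (@cycle_adj_sym n) (@cycle_adj_irr n).

Definition path_adj n : rel 'I_n :=
  fun i j => (val j == i.+1) || (val i == j.+1).

Lemma path_adj_sym n : symmetric (@path_adj n).
Proof. by move=> i j; rewrite /path_adj orbC. Qed.

Lemma path_adj_irr n : irreflexive (@path_adj n).
Proof. by move=> i; rewrite /path_adj orbb ltn_eqF. Qed.

Definition path_graph n := SGraph (@path_adj_sym n) (@path_adj_irr n).

Definition complete_adj n : rel 'I_n := fun i j => i != j.

Lemma complete_adj_sym n : symmetric (@complete_adj n).
Proof. by move=> i j; rewrite /complete_adj eq_sym. Qed.

Lemma complete_adj_irr n : irreflexive (@complete_adj n).
Proof. by move=> i; rewrite /complete_adj eqxx. Qed.

Definition complete_graph n :=
  SGraph (@complete_adj_sym n) (@complete_adj_irr n).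

Variables G H : sgraph.

Definition cart_adj : rel (G * H) :=
  fun x y => (x.1 == y.1) && adj x.2 y.2 || (x.2 == y.2) && adj x.1 y.1.

Lemma cart_adj_sym : symmetric cart_adj.
Proof.
by move=> x y; rewrite /cart_adj !(eq_sym _ y.1) !(eq_sym _ y.2) !(adj_sym _ y.1)
  !(adj_sym _ y.2).
Qed.

Lemma cart_adj_irr : irreflexive cart_adj.
Proof. by move=> x; rewrite /cart_adj !adj_irr !andbF. Qed.

Definition cart_prod := SGraph cart_adj_sym cart_adj_irr.

Definition join_adj : rel (G + H) := fun x y =>
  match x, y with
  | inl u, inl v => adj u v
  | inr u, inr v => adj u v
  | _, _ => true
  end.

Lemma join_adj_sym : symmetric join_adj.
Proof. by case=> x [] y //=; rewrite adj_sym. Qed.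

Lemma join_adj_irr : irreflexive join_adj.
Proof. by case=> x /=; rewrite adj_irr. Qed.

Definition join_graph := SGraph join_adj_sym join_adj_irr.

End Constructions.

Definition djembe (n : nat) : sgraph :=
  join_graph (cart_prod (cycle_graph n) (path_graph 2)) (complete_graph 1).

Section Colouring.
Variable G : sgraph.

Definition proper_col k (f : {ffun G -> 'I_k}) : bool :=
  [forall x, forall y, adj x y ==> (f x != f y)].

Definition colourable k : bool := [exists f : {ffun G -> 'I_k}, proper_col f].

Lemma colourable_ex : exists k, colourable k.
Proof.
exists #|G|; apply/existsP; exists [ffun x => enum_rank x].
apply/forallP=> x; apply/forallP=> y; apply/implyP=> xy; rewrite !ffunE.
by apply: contraTneq xy => /enum_rank_inj ->; rewrite adj_irr.
Qed.

Definition chi : nat := ex_minn colourable_ex.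

Definition theta k (f : {ffun G -> 'I_k}) (c : 'I_k) : nat :=
  #|[set x | f x == c]|.

Definition chromatic_col (f : {ffun G -> 'I_chi}) : bool :=
  proper_col f && [forall c, exists x, f x == c].

(* The colour c_i is the index i - 1 of 'I_chi, so tuples list theta(c_1) first
   and are compared in the lexicographic order of [tuplelexi]. *)
Definition theta_tuple (f : {ffun G -> 'I_chi}) : chi.-tuplelexi nat :=
  [tuple theta f c | c < chi].

Definition chi_minus_col (f : {ffun G -> 'I_chi}) : bool :=
  chromatic_col f &&
  [forall g, chromatic_col g ==> (theta_tuple g <= theta_tuple f)%O].

Lemma chromatic_col_ex : exists f, chromatic_col f.
Proof.
have [f pf minf] : exists2 f : {ffun G -> 'I_chi}, proper_col f &
    forall k, colourable k -> chi <= k.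
  rewrite /chi; case: ex_minnP => m /existsP[f pf] mmin.
  by exists f.
exists f; rewrite /chromatic_col pf; apply/forallP=> c.
apply: contraT => /existsPn fc.
have /fin_all_exists[h hP] x : exists j, f x = lift c j.
  have cfx : c != f x by rewrite eq_sym.
  by have [j -> _] := unlift_some cfx; exists j.
suff /minf : colourable chi.-1.
  by rewrite leqNgt ltn_predL (leq_ltn_trans _ (ltn_ord c)).
apply/existsP; exists [ffun x => h x].
apply/forallP=> x; apply/forallP=> y; apply/implyP=> xy; rewrite !ffunE.
have := implyP (forallP (forallP pf x) y) xy.
by rewrite !hP (inj_eq lift_inj).
Qed.

Lemma chi_minus_col_ex : exists f, chi_minus_col f.
Proof.
have [f0 cf0] := chromatic_col_ex.
case: (@Order.TotalTheory.arg_maxP _ _ _ f0 chromatic_col theta_tuple cf0) => f cf fmax.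
exists f; rewrite /chi_minus_col cf.
by apply/forallP=> g; apply/implyP; apply: fmax.
Qed.

(* Any choice will do, see [cn_chiE] and [ccn_chiE] below. *)
Definition chi_minus : {ffun G -> 'I_chi} := xchoose chi_minus_col_ex.

Definition cn_chi : nat := \max_(c < chi) theta chi_minus c.

Definition ccn_chi : nat := \prod_(c < chi) theta chi_minus c.

Lemma theta_chi_minus f : chi_minus_col f -> theta f =1 theta chi_minus.
Proof.
have /andP[cg /forallP gmax] := xchooseP chi_minus_col_ex.
move=> /andP[cf /forallP fmax] c.
have e : theta_tuple f = theta_tuple chi_minus.
  by apply/le_anti; rewrite (implyP (gmax f) cf) (implyP (fmax chi_minus) cg).
by have := congr1 (fun t : chi.-tuple nat => tnth t c) e; rewrite !tnth_mktuple.
Qed.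

Lemma cn_chiE f : chi_minus_col f -> cn_chi = \max_(c < chi) theta f c.
Proof. by move=> /theta_chi_minus e; apply: eq_bigr => c _; rewrite e. Qed.

Lemma ccn_chiE f : chi_minus_col f -> ccn_chi = \prod_(c < chi) theta f c.
Proof. by move=> /theta_chi_minus e; apply: eq_bigr => c _; rewrite e. Qed.

End Colouring.

(* Main.v *)
(* In a proper colouring of Dj_n the external vertex is alone in its colour
   class, and any class meets each rim in an independent set of the cycle, so
   it has at most m = 2 * floor(n / 2) vertices. Counting vertices gives the
   lower bound on chi, and explicit colourings attain it with two classes of
   size m. A lexicographically maximal colouring then has theta(c_1) =
   theta(c_2) = m, and since the class sizes add up to 2n + 1, the others are
   {1} for n even and {1, 2} in some order for n odd. *)
Require Import Defs.
From mathcomp Require Import all_boot all_order zify.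

Set Implicit Arguments.
Unset Strict Implicit.
Unset Printing Implicit Defensive.

(** The order compares second coordinates only once the first ones are equal, and the reverse bound
    on the first ones forces that equality. *)
Lemma lexi_le2 k (s t : k.+2.-tuplelexi nat) (i0 := ord0 : 'I_k.+2)
    (i1 := lift ord0 ord0 : 'I_k.+2) :
  (s <= t)%O -> tnth t i0 <= tnth s i0 -> tnth t i1 <= tnth s i1 ->
  tnth t i0 = tnth s i0 /\ tnth t i1 = tnth s i1.
Proof.
case/tupleP: s => s0 s; case/tupleP: s => s1 s.
case/tupleP: t => t0 t; case/tupleP: t => t1 t.
rewrite !(tnth_nth 0) /= [(_ <= _)%O]Order.SeqLexiOrder.lexi_cons.
rewrite Order.SeqLexiOrder.lexi_cons !Order.NatOrder.leEnat.
lia.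
Qed.

(** * Class sizes and $\chi^-$-colourings of an arbitrary graph *)

Section ChromaticColourings.
Variable G : sgraph.

Lemma sum_theta k (f : {ffun G -> 'I_k}) : \sum_c theta f c = #|G|.
Proof.
rewrite -sum1_card (partition_big f xpredT) //=; apply: eq_bigr => c _.
by rewrite /theta -sum1_card; apply: eq_bigl => x; rewrite inE.
Qed.

Lemma chi_eq k (f : {ffun G -> 'I_k}) :
  proper_col f -> (forall l (g : {ffun G -> 'I_l}), proper_col g -> k <= l) ->
  chi G = k.
Proof.
move=> pf kmin; rewrite /chi; case: ex_minnP => m /existsP[g pg] mmin.
apply/eqP; rewrite eqn_leq (kmin _ g pg) andbT; apply: mmin.
by apply/existsP; exists f.
Qed.

(** The lexicographic maximum lies above the size tuple of [g], while [g] bounds the first two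
    classes of every proper colouring, so the two colourings agree on these classes. The witness is
    [chi_minus G], moved to the concrete type ['I_k.+2] so that sums and products over colours can
    be expanded. *)
Lemma chi_minus_spec k (g : {ffun G -> 'I_k.+2}) (i0 := ord0 : 'I_k.+2)
    (i1 := lift ord0 ord0 : 'I_k.+2) :
    chi G = k.+2 -> proper_col g -> (forall c, 0 < theta g c) ->
    (forall f : {ffun G -> 'I_k.+2}, proper_col f ->
      theta f i0 <= theta g i0 /\ theta f i1 <= theta g i1) ->
  exists f : {ffun G -> 'I_k.+2},
    [/\ proper_col f, forall c, 0 < theta f c,
        theta f i0 = theta g i0 /\ theta f i1 = theta g i1,
        cn_chi G = \max_c theta f c & ccn_chi G = \prod_c theta f c].
Proof.
have chromE l (h : {ffun G -> 'I_l}) :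
    [forall c, exists x, h x == c] = [forall c, 0 < theta h c].
  apply: eq_forallb => c; apply/existsP/idP => [[x xc]|].
    by apply/card_gt0P; exists x; rewrite inE.
  by case/card_gt0P=> x; rewrite inE => xc; exists x.
have : chi_minus_col (chi_minus G) by exact: xchooseP.
case/andP=> /andP[pm].
rewrite chromE => /forallP m_gt0 /forallP.
rewrite /chromatic_col /theta_tuple /cn_chi /ccn_chi.
move: (chi_minus G) pm m_gt0 => + + + + chik.
(* The type of the colouring depends on [chi G], so both are generalised before [k.+2] is
   substituted. *)
move: chik; move: (chi G) => l el; subst l => f pf f_gt0 fmax pg g_gt0 gmax.
exists f; split=> //.
have := fmax g; rewrite pg chromE.
have -> : [forall c, 0 < theta g c] by apply/forallP.
have [le0 le1] := gmax f pf.
move=> /lexi_le2 /=; rewrite !tnth_mktuple; exact.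
Qed.

End ChromaticColourings.

(** * Colourings of the djembe graph: bounds, then constructions *)

Section Djembe.
Variable n : nat.
Hypothesis n_ge3 : 2 < n.

Definition hub : djembe n := inr ord0.
Definition rim (b : 'I_2) (i : 'I_n) : djembe n := inl (i, b).

Lemma rim_inj b : injective (rim b).
Proof. by move=> i j []. Qed.

Lemma card_djembe : #|djembe n| = n.*2.+1.
Proof. by rewrite card_sum card_prod !card_ord muln2 addn1. Qed.

(** [A] and its shift by [ordS] are disjoint and equinumerous, so twice the size of [A] is at most
    [n]. *)
Lemma cycle_independent (A : {set 'I_n}) :
  (forall i, i \in A -> ordS i \notin A) -> #|A| <= n./2.
Proof.
move=> indA; rewrite -[#|A|]doubleK; apply: half_leq.
have dis : [disjoint A & @ordS n @: A].
  rewrite -setI_eq0; apply/eqP/setP=> i; rewrite !inE.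
  apply/negP=> /andP[iA /imsetP[j /indA jA e]].
  by rewrite -e iA in jA.
rewrite -addnn -[X in _ + X](card_imset _ (@ordS_inj n)) -cardsUI.
by rewrite disjoint_setI0 // cards0 addn0 -[X in _ <= X]card_ord max_card.
Qed.

Lemma adj_rim_ordS b i : adj (rim b i) (rim b (ordS i)).
Proof.
rewrite /= /cart_adj /= /cycle_adj !eqxx /= andbT; apply/orP; right.
apply/eqP=> /(congr1 val) /=; case: (ltnP i.+1 n) => [/modn_small ->|]; first lia.
move=> ni; have -> : i.+1 = n by have := ltn_ord i; lia.
by rewrite modnn; have := ltn_ord i; lia.
Qed.

Section Proper.
Variables (k : nat) (f : {ffun djembe n -> 'I_k}).
Hypothesis pf : proper_col f.

Lemma proper_neq x y : adj x y -> f x != f y.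
Proof. by move=> xy; apply: (implyP (forallP (forallP pf x) y)). Qed.

Lemma theta_hub : theta f (f hub) = 1.
Proof.
rewrite /theta -(cards1 hub); apply: eq_card => -[x|x]; rewrite !inE.
  by apply/negbTE/proper_neq.
by rewrite /hub [x]ord1 !eqxx.
Qed.

Lemma theta_le c : theta f c <= n./2.*2.
Proof.
have [<-|chub] := eqVneq (f hub) c; first by rewrite theta_hub; lia.
pose A b := [set i | f (rim b i) == c].
have A_le b : #|A b| <= n./2.
  apply: cycle_independent => i; rewrite !inE => /eqP <-.
  by rewrite eq_sym proper_neq // adj_rim_ordS.
have : [set x | f x == c] \subset rim ord0 @: A ord0 :|: rim ord_max @: A ord_max.
  apply/subsetP=> -[[i b]|x]; rewrite !inE; last first.
    by rewrite [x]ord1 (negbTE chub).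
  move=> fc; apply/orP; case: (unliftP ord0 b) => [b' eb|eb]; [right|left];
    apply/imsetP; exists i; rewrite ?inE /rim.
  - by rewrite -[ord_max](_ : b = _) //; apply/val_inj; rewrite eb /= [b']ord1.
  - by congr (inl (_, _)); apply/val_inj; rewrite eb /= [b']ord1.
  - by rewrite -eb.
  - by rewrite eb.
move/subset_leq_card/leq_trans; apply; rewrite cardsU.
by rewrite !card_imset; try exact: rim_inj; have := A_le ord0; have := A_le ord_max; lia.
Qed.

Lemma sum_theta_not_hub : \sum_(c | c != f hub) theta f c = n.*2.
Proof.
by have := sum_theta f; rewrite card_djembe (bigD1 (f hub)) //= theta_hub => -[].
Qed.

(** The $2n$ rim vertices are shared by the $k-1$ colours other than that of the hub. For odd [n],
    two such classes hold at most $2n-2$ vertices, so a third is required. *)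
Lemma colours_ge : (if odd n then 4 else 3) <= k.
Proof.
have : n.*2 <= k.-1 * n./2.*2.
  rewrite -sum_theta_not_hub.
  apply: (@leq_trans (\sum_(c | c != f hub) n./2.*2)).
    by apply: leq_sum => c _; apply: theta_le.
  rewrite sum_nat_const leq_mul2r; apply/orP; right.
  by rewrite (eq_card (B := predC1 (f hub))) // cardC1 card_ord.
have := odd_double_half n; case: odd; case: k => [|[|[|[|]]]] //=; nia.
Qed.

End Proper.

(** Reduces an explicit colouring to arithmetic: [col i b] is the colour in column [i] of rim [b],
    the hub takes the fresh colour [k], and the last condition is the edge closing each cycle. *)
Lemma rim_colouring k (col : nat -> nat -> nat) :
    (forall i b, i < n -> b < 2 -> col i b < k) ->
    (forall i, i < n -> col i 0 != col i 1) ->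
    (forall i b, i.+1 < n -> b < 2 -> col i b != col i.+1 b) ->
    (forall b, b < 2 -> col n.-1 b != col 0 b) ->
  exists f : {ffun djembe n -> 'I_k.+1},
    [/\ proper_col f, f hub = ord_max & forall b i, val (f (rim b i)) = col i b].
Proof.
move=> col_lt col_path col_next col_last.
pose f : {ffun djembe n -> 'I_k.+1} :=
  [ffun x : djembe n => if x is inl u then inord (col u.1 u.2) else ord_max].
have f_rim b i : val (f (rim b i)) = col i b.
  by rewrite ffunE /= inordK // ltnW // ltnS col_lt.
exists f; split=> //; last by rewrite ffunE.
have f_hub x : f (inr x) = ord_max by rewrite ffunE.
have col_ordS b (i : 'I_n) : b < 2 -> col i b != col (ordS i) b.
  move=> b2 /=; have i_lt := ltn_ord i.
  have [/[dup] ni /modn_small ->|ni] := ltnP i.+1 n; first exact: col_next.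
  have -> : i.+1 = n by lia.
  have -> : nat_of_ord i = n.-1 by lia.
  by rewrite modnn col_last.
apply/forallP=> -[[i b]|x]; apply/forallP=> -[[j c]|y]; apply/implyP=> //=.
- rewrite -val_eqE !f_rim /cart_adj /=.
  case/orP=> /andP[/eqP e].
    rewrite /path_adj e => {e}; case: b c => [[|[|b]] //= ?] [[|[|c]] //= ?] // _.
      exact: col_path.
    by rewrite eq_sym col_path.
  rewrite /cycle_adj e => /andP[_ /orP[]/eqP->]; first exact: col_ordS.
  by rewrite eq_sym col_ordS.
- by move=> _; rewrite -val_eqE f_rim f_hub ltn_eqF // col_lt.
- by move=> _; rewrite -val_eqE f_rim f_hub gtn_eqF // col_lt.
by rewrite [x]ord1 [y]ord1 /complete_adj eqxx.
Qed.

Lemma even_colouring : ~~ odd n -> exists g : {ffun djembe n -> 'I_3},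
  [/\ proper_col g, forall c, 0 < theta g c,
      theta g ord0 = n & theta g (lift ord0 ord0) = n].
Proof.
move=> n_even; pose col i b := nat_of_bool (odd (i + b)).
have [||||g [pg g_hub _]] := @rim_colouring 2 col.
- by move=> i b _ _; rewrite /col; case: odd.
- by move=> i _; rewrite /col addn0 addn1 /=; case: odd.
- by move=> i b _ _; rewrite /col addSn /=; case: odd.
- move=> b _; rewrite /col !oddD; have -> : odd n.-1 by lia.
  by rewrite /=; case: odd.
(* No class is counted directly: the hub leaves $2n$ vertices to two classes of size at most [n], so
   both bounds are attained. *)
have g_sum := sum_theta g; have g2 := theta_hub pg; rewrite g_hub in g2.
have e2 : ord_max = lift ord0 (lift ord0 ord0) :> 'I_3 by apply: val_inj.
rewrite {}e2 in g2.
rewrite card_djembe !big_ord_recl big_ord0 g2 in g_sum.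
have g0_le := theta_le pg ord0; have g1_le := theta_le pg (lift ord0 ord0).
have half_n : n./2.*2 = n by lia.
exists g; split=> //; try lia.
move=> c; case: (unliftP ord0 c) => [c1|] ->; last by lia.
case: (unliftP ord0 c1) => [c2|] ->; last by lia.
by rewrite [c2]ord1 g2.
Qed.

(* The colour 2 is used on one vertex of each rim, in different columns, which
   leaves n - 1 vertices to each of the colours 0 and 1. *)
Lemma odd_colouring : odd n -> exists g : {ffun djembe n -> 'I_4},
  [/\ proper_col g, forall c, 0 < theta g c,
      theta g ord0 = n.-1 & theta g (lift ord0 ord0) = n.-1].
Proof.
move=> n_odd.
(* The rims alternate in opposite phase. As $n-1$ is even, columns $n-1$ and $0$ would clash on each
   rim, so one of these two vertices is recoloured. *)
pose col i b := if b == 0 then if i == n.-1 then 2 else nat_of_bool (odd i)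
                else if i == 0 then 2 else nat_of_bool (~~ odd i).
have [|||b b2|g [pg g_hub g_rim]] := @rim_colouring 3 col.
- by move=> i b _ _; rewrite /col; do ?case: ifP => //; case: odd.
- move=> i i_lt; rewrite /col /=.
  have [->|_] := eqVneq i n.-1; last by case: ifP => _ //; case: odd.
  have -> : (n.-1 == 0) = false by lia.
  by case: odd.
- move=> i b i_lt _; rewrite /col /=.
  have -> : (i == n.-1) = false by lia.
  by do ?case: ifP => //; case: odd.
- rewrite /col !eqxx; have -> : (0 == n.-1) = false by lia.
  have -> : (n.-1 == 0) = false by lia.
  by case: ifP => _ //; case: odd.
have g_sum := sum_theta g; have g3 := theta_hub pg.
have g_le c := theta_le pg c.
(* An upper bound is enough: with one vertex for the hub, the other two classes share at least
   $2n-2$ vertices and have at most $n-1$ each. *)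
have g2 : theta g (lift ord0 (lift ord0 ord0)) <= 2.
  have n1 : n.-1 < n by lia.
  have n0 : 0 < n by lia.
  pose S := [set rim ord0 (Ordinal n1); rim ord_max (Ordinal n0)].
  apply: (@leq_trans #|S|); last by rewrite cards2; case: eqP.
  apply: subset_leq_card; apply/subsetP=> -[[i b]|x]; rewrite inE -val_eqE.
    rewrite -/(rim b i) g_rim /col => gi.
    have {gi} : if val b == 0 then val i == n.-1 else val i == 0.
      by move: gi; do ?case: ifP => // _; case: odd.
    rewrite !inE; case: eqP => eb /eqP ei; apply/orP; [left|right];
      apply/eqP; congr (inl (_, _)); apply: val_inj => //=.
    by move: eb (ltn_ord b) => /=; lia.
  by have -> : g (inr x) = ord_max by rewrite -g_hub /hub [x]ord1.
rewrite g_hub in g3; move: g_sum; rewrite card_djembe.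
have e3 : ord_max = lift ord0 (lift ord0 (lift ord0 ord0)) :> 'I_4 by apply: val_inj.
rewrite e3 in g3.
rewrite !big_ord_recl big_ord0 g3 => g_sum.
have g0_le := g_le ord0; have g1_le := g_le (lift ord0 ord0).
have half_n : n./2.*2 = n.-1 by lia.
exists g; split=> //; try lia.
move=> c; case: (unliftP ord0 c) => [c1|] ->; last by lia.
case: (unliftP ord0 c1) => [c2|] ->; last by lia.
case: (unliftP ord0 c2) => [c3|] ->; last by lia.
by rewrite [c3]ord1; lia.
Qed.

End Djembe.

Theorem theorem7 (n : nat) (hn : 3 <= n) :
  cn_chi (djembe n) = (if odd n then n - 1 else n) /\
  ccn_chi (djembe n) = (if odd n then 2 * (n - 1) ^ 2 else n ^ 2).
Proof.
have class_le k (f : {ffun djembe n -> 'I_k}) := theta_le hn (f := f).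
have := colours_ge hn; case: ifP => [n_odd|/negbT n_even] k_ge.
- have half_n : n./2.*2 = n.-1 by lia.
  have [g [pg g_gt0 g0 g1]] := odd_colouring hn n_odd.
  have chi4 : chi (djembe n) = 4 by apply: chi_eq pg _.
  have [f pf|f [pf f_gt0 [f0 f1] -> ->]] := chi_minus_spec chi4 pg g_gt0.
    by rewrite g0 g1 -half_n !class_le.
  have := sum_theta f; rewrite card_djembe !big_ord_recl !big_ord0 f0 f1 g0 g1.
  have := f_gt0 (lift ord0 (lift ord0 ord0)).
  have := f_gt0 (lift ord0 (lift ord0 (lift ord0 ord0))).
  set a := theta f _; set b := theta f _ => b_gt0 a_gt0 ab.
  (* The last two classes are nonempty and share $2n+1-2(n-1)=3$ vertices. In either order the
     product is the same, and the maximum stays $n-1\ge 2$. *)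
  have [[-> ->]|[-> ->]] : (a = 1 /\ b = 2) \/ (a = 2 /\ b = 1) by lia.
    by split; lia.
  by split; lia.
have half_n : n./2.*2 = n by lia.
have [g [pg g_gt0 g0 g1]] := even_colouring hn n_even.
have chi3 : chi (djembe n) = 3 by apply: chi_eq pg _.
have [f pf|f [pf f_gt0 [f0 f1] -> ->]] := chi_minus_spec chi3 pg g_gt0.
  by rewrite g0 g1 -[X in _ <= X /\ _ <= X]half_n !class_le.
have := sum_theta f; rewrite card_djembe !big_ord_recl !big_ord0 f0 f1 g0 g1.
set a := theta f _ => ab.
have -> : a = 1 by lia.
by split; lia.
Qed.
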